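(* Let $\nu>-1$ and let $j_{\nu,1}$ be the first positive zero of the Bessel function of the first kind $J_\nu$. Put $\epsilon_\nu=0$ and $\varepsilon_\nu=1$. Then for all real $x$ with $|x|<j_{\nu,1}$, $$\left(\frac{j_{\nu,1}^2}{j_{\nu,1}^2-x^2}\right)^{\epsilon_\nu}\leq\frac{\left(\mathcal{J}_{\nu+1}(x)\right)^{\frac{\nu+2}{\nu+1}}}{\mathcal{J}_\nu(x)}\leq\left(\frac{j_{\nu,1}^2}{j_{\nu,1}^2-x^2}\right)^{\varepsilon_\nu}.$$ Moreover the constants are best possible: $\epsilon_\nu=0$ is the largest real exponent for which the left-hand inequality holds for all $|x|<j_{\nu,1}$, and $\varepsilon_\nu=1$ is the smallest real exponent for which the right-hand inequality holds for all $|x|<j_{\nu,1}$.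
   Context: For $\nu>-1$, $J_\nu$ is the Bessel function of the first kind, $J_\nu(x)=\sum_{n\ge0}\frac{(-1)^n}{n!\,\Gamma(\nu+n+1)}\left(\frac{x}{2}\right)^{2n+\nu}$ for $x>0$, and $j_{\nu,1}$ is its smallest positive zero. The normalized Bessel function is $\mathcal{J}_\nu(x)=\sum_{n\ge0}\frac{(-1)^n\,\Gamma(\nu+1)}{n!\,\Gamma(\nu+n+1)}\left(\frac{x}{2}\right)^{2n}$ for $x\in\mathbb{R}$; thus $\mathcal{J}_\nu(x)=2^\nu\Gamma(\nu+1)x^{-\nu}J_\nu(x)$ for $x>0$ and $\mathcal{J}_\nu(0)=1$. Both $\mathcal{J}_\nu$ and $\mathcal{J}_{\nu+1}$ are positive on $(-j_{\nu,1},j_{\nu,1})$, so the real power and the quotient are well defined. *)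

(* Defs.v *)
From Stdlib Require Import Arith Reals.
From Coquelicot Require Import Coquelicot.
Open Scope R_scope.

(* Euler's integral; the meaningful range is 0 < s, and only such arguments
   occur below, since nu + n + 1 > 0 for nu > -1. *)
Definition Gamma (s : R) : R :=
  RInt_gen (fun t => Rpower t (s - 1) * exp (- t))
           (at_right 0) (Rbar_locally p_infty).

(* Meaningful for 0 < x only: [Rpower] has a junk value on nonpositive bases. *)
Definition BesselJ (nu x : R) : R :=
  Series (fun n =>
    (-1) ^ n / (INR (fact n) * Gamma (nu + INR n + 1))
    * Rpower (x / 2) (2 * INR n + nu)).

Definition normBesselJ (nu x : R) : R :=
  Series (fun n =>
    (-1) ^ n * Gamma (nu + 1) / (INR (fact n) * Gamma (nu + INR n + 1))
    * (x / 2) ^ (2 * n)).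

Definition is_first_positive_zero (f : R -> R) (j : R) : Prop :=
  0 < j /\ f j = 0 /\ forall x, 0 < x -> f x = 0 -> j <= x.

(* Main.v *)
(** In the variable [t = (x/2)^2], and with [a = nu + 1], the normalized Bessel
    functions [f], [g] of orders [nu], [nu + 1] satisfy [f' = - g / a] and
    [t g' = a (f - g)].  Put [T = (j/2)^2].  All inequalities follow from one
    principle: if [t V' + a V >= 0] on [[0, T]] then [V >= 0] there.

    For [V = t g^2 - a (a + 1) f (g - f)] one has [t V' + a V = 2 t g (g - f)], and
    the derivative of the logarithm of the quotient is [V / (a t f g)]: this is the
    lower bound.  For [V = t g^2 / a - (g - f) (g + a f)] one has
    [t V' + a V = a (g - f)^2], which says that [(g - f) / (t g)] is nondecreasing;
    comparing with its value [1 / T] at [T] gives [g (1 - t / T) <= f], and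
    [g^((a + 1) / a) <= g] because [g <= 1]: this is the upper bound.

    The lower exponent is sharp because the logarithm of the quotient has derivative
    [0] at [t = 0], the upper one because [f <= (T - t) / a] while [g >= g T > 0]. *)
Require Import Defs.
From Stdlib Require Import Arith Reals.
From Coquelicot Require Import Coquelicot.
From Stdlib Require Import Lra.
Open Scope R_scope.

(** * Monotone limits and improper integrals of positive functions on the half line *)

Lemma exp_le (x y : R) : x <= y -> exp x <= exp y.
Proof.
  intros [Hlt | ->]; [now apply Rlt_le, exp_increasing | apply Rle_refl].
Qed.

Lemma Rpower_1_l (y : R) : Rpower 1 y = 1.
Proof. unfold Rpower; now rewrite ln_1, Rmult_0_r, exp_0. Qed.

(** The limit is the supremum of the values on [[1, +oo)]. The bound by [L] is kept in the
    conclusion because it later yields a positive lower bound for the integral. *)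
Lemma filterlim_pinfty_nondecreasing_bounded (F : R -> R) (M : R) :
  (forall x y, 1 <= x -> x <= y -> F x <= F y) ->
  (forall x, 1 <= x -> F x <= M) ->
  exists L, (forall x, 1 <= x -> F x <= L) /\
    filterlim F (Rbar_locally p_infty) (locally L).
Proof.
  intros Hmono Hbd.
  destruct (completeness (fun y => exists x, 1 <= x /\ y = F x)) as [L [Hub Hlub]].
  - exists M; intros y [x [Hx ->]]; auto.
  - exists (F 1), 1; split; [lra | reflexivity].
  - exists L; split; [intros x Hx; apply Hub; exists x; split; [exact Hx | reflexivity] |].
    intros P [eps HP].
    assert (Hx0 : exists x0, 1 <= x0 /\ L - eps < F x0).
    { apply Classical_Prop.NNPP; intros Hno.
      assert (L <= L - eps); [| destruct eps; simpl in *; lra].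
      apply Hlub; intros y [x [Hx ->]].
      apply Rnot_lt_le; intros Hlt; apply Hno; exists x; split; assumption. }
    destruct Hx0 as [x0 [Hx0 HF]].
    exists x0; intros x Hx; apply HP.
    assert (F x0 <= F x) by (apply Hmono; lra).
    assert (F x <= L) by (apply Hub; exists x; split; [lra | reflexivity]).
    apply Rabs_def1; unfold minus, plus, opp; simpl; destruct eps; simpl in *; lra.
Qed.

(** The substitution [u = 1 / x] carries this to the limit at infinity. *)
Lemma filterlim_at_right_0_nonincreasing_bounded (F : R -> R) (M : R) :
  (forall x y, 0 < x -> x <= y -> y <= 1 -> F y <= F x) ->
  (forall x, 0 < x -> x <= 1 -> F x <= M) ->
  exists L, (forall x, 0 < x -> x <= 1 -> F x <= L) /\
    filterlim F (at_right 0) (locally L).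
Proof.
  intros Hmono Hbd.
  destruct (filterlim_pinfty_nondecreasing_bounded (fun u => F (/ u)) M)
    as [L [HL Hlim]].
  - intros x y Hx Hxy; apply Hmono.
    + apply Rinv_0_lt_compat; lra.
    + apply Rinv_le_contravar; lra.
    + rewrite <- Rinv_1; apply Rinv_le_contravar; lra.
  - intros x Hx; apply Hbd.
    + apply Rinv_0_lt_compat; lra.
    + rewrite <- Rinv_1; apply Rinv_le_contravar; lra.
  - exists L; split.
    { intros x Hx Hx1; rewrite <- (Rinv_inv x); apply HL.
      rewrite <- Rinv_1; now apply Rinv_le_contravar. }
    apply filterlim_ext with (fun x => F (/ / x)).
    + intros x; now rewrite Rinv_inv.
    + exact (filterlim_comp _ _ _ _ _ _ _ _ filterlim_Rinv_0_right Hlim).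
Qed.

Lemma ex_RInt_half_line (f : R -> R) (a b : R) :
  (forall x, 0 < x -> continuous f x) -> 0 < a -> 0 < b -> ex_RInt f a b.
Proof.
  intros Hc Ha Hb; apply (ex_RInt_continuous (V := R_CompleteNormedModule)).
  intros x [Hx _]; apply Hc.
  apply Rlt_le_trans with (2 := Hx); now apply Rmin_glb_lt.
Qed.

Lemma is_RInt_gen_half_line (f : R -> R) (l0 l1 : R) :
  (forall x, 0 < x -> continuous f x) ->
  filterlim (fun a => RInt f a 1) (at_right 0) (locally l0) ->
  filterlim (fun b => RInt f 1 b) (Rbar_locally p_infty) (locally l1) ->
  is_RInt_gen f (at_right 0) (Rbar_locally p_infty) (l0 + l1).
Proof.
  intros Hc H0 H1.
  refine (is_RInt_gen_Chasles (V := R_NormedModule) f 1 l0 l1 _ _).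
  - intros P HP; apply Filter_prod with
      (Q := fun a => 0 < a /\ P (RInt f a 1)) (R := fun b => b = 1).
    + apply filter_and; [exists (mkposreal 1 Rlt_0_1); tauto | exact (H0 P HP)].
    + reflexivity.
    + intros a b [Ha HPa] ->; exists (RInt f a 1); split; [| exact HPa].
      apply (RInt_correct (V := R_CompleteNormedModule)).
      apply ex_RInt_half_line; [exact Hc | exact Ha | lra].
  - intros P HP; apply Filter_prod with
      (Q := fun a => a = 1) (R := fun b => 0 < b /\ P (RInt f 1 b)).
    + reflexivity.
    + apply filter_and; [exists 0; tauto | exact (H1 P HP)].
    + intros a b -> [Hb HPb]; exists (RInt f 1 b); split; [| exact HPb].
      apply (RInt_correct (V := R_CompleteNormedModule)).
      apply ex_RInt_half_line; [exact Hc | lra | exact Hb].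
Qed.

(** Positivity makes the integrals over [[a, 1]] and [[1, b]] monotone in [a] and [b], so bounds
    alone force convergence. The total is strictly positive because it dominates the integral over
    [[1, 2]]. *)
Lemma RInt_gen_half_line_pos (f : R -> R) (M0 M1 : R) :
  (forall x, 0 < x -> continuous f x) ->
  (forall x, 0 < x -> 0 < f x) ->
  (forall a, 0 < a -> a <= 1 -> RInt f a 1 <= M0) ->
  (forall b, 1 <= b -> RInt f 1 b <= M1) ->
  exists l, 0 < l /\ is_RInt_gen f (at_right 0) (Rbar_locally p_infty) l.
Proof.
  intros Hc Hpos H0 H1.
  assert (Hge : forall a b, 0 < a -> a <= b -> 0 <= RInt f a b).
  { intros a b Ha Hab; apply RInt_ge_0; [exact Hab | apply ex_RInt_half_line; auto; lra |].
    intros x Hx; apply Rlt_le, Hpos; lra. }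
  destruct (filterlim_at_right_0_nonincreasing_bounded (fun a => RInt f a 1) M0)
    as [l0 [Hl0 Hlim0]]; [| exact H0 |].
  { intros x y Hx Hxy Hy.
    rewrite <- (RInt_Chasles f x y 1) by (apply ex_RInt_half_line; auto; lra).
    generalize (Hge x y Hx Hxy); unfold plus; simpl; lra. }
  destruct (filterlim_pinfty_nondecreasing_bounded (fun b => RInt f 1 b) M1)
    as [l1 [Hl1 Hlim1]]; [| exact H1 |].
  { intros x y Hx Hxy.
    rewrite <- (RInt_Chasles f 1 x y) by (apply ex_RInt_half_line; auto; lra).
    assert (Hx0 : 0 < x) by lra.
    generalize (Hge x y Hx0 Hxy); unfold plus; simpl; lra. }
  exists (l0 + l1); split; [| now apply is_RInt_gen_half_line].
  assert (0 <= l0).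
  { apply Rle_trans with (RInt f 1 1); [apply Hge | apply Hl0]; lra. }
  assert (0 < RInt f 1 2).
  { apply RInt_gt_0; [lra | |]; intros x Hx; [apply Hpos | apply Hc]; lra. }
  assert (RInt f 1 2 <= l1) by (apply Hl1; lra).
  lra.
Qed.

(** * Euler's integral: convergence, positivity and functional equation *)

Lemma is_derive_Rpower (s t : R) :
  0 < t -> is_derive (fun x => Rpower x s) t (s * Rpower t (s - 1)).
Proof. intros Ht; apply is_derive_Reals; now apply derivable_pt_lim_power. Qed.

Lemma continuous_Rpower_exp (s t : R) :
  0 < t -> continuous (fun x => Rpower x s * exp (- x)) t.
Proof.
  intros Ht; apply (ex_derive_continuous (V := R_NormedModule)).
  eexists; apply (is_derive_mult (fun x => Rpower x s) (fun x => exp (- x))).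
  - now apply is_derive_Rpower.
  - auto_derive; [trivial | reflexivity].
  - intros; apply Rmult_comm.
Qed.

Lemma is_derive_Rpower_exp (s t : R) :
  0 < t ->
  is_derive (fun x => Rpower x s * exp (- x)) t
    (s * (Rpower t (s - 1) * exp (- t)) - Rpower t s * exp (- t)).
Proof.
  intros Ht.
  replace (s * (Rpower t (s - 1) * exp (- t)) - Rpower t s * exp (- t))
    with (plus (mult (s * Rpower t (s - 1)) (exp (- t)))
            (mult (Rpower t s) (- exp (- t)))) by (unfold plus, mult; simpl; ring).
  apply (is_derive_mult (fun x => Rpower x s) (fun x => exp (- x))).
  - now apply is_derive_Rpower.
  - auto_derive; [trivial | ring].
  - intros; apply Rmult_comm.
Qed.

Lemma Rpower_exp_le (s : R) :
  exists C, forall t, 1 <= t -> Rpower t s * exp (- t) <= exp C * exp (- t / 2).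
Proof.
  (* In [ln t <= t / k + ln k], this [k] is large enough that [|s| t / k <= t / 2], so the power
     costs at most half of the exponential decay. *)
  set (k := 2 * Rabs s + 1).
  assert (Hs := Rabs_pos s).
  assert (Hk : 0 < k) by (unfold k; lra).
  exists (Rabs s * ln k); intros t Ht.
  unfold Rpower; rewrite <- !exp_plus; apply exp_le.
  assert (Hln : 0 <= ln t) by (rewrite <- ln_1; apply ln_le; lra).
  assert (s * ln t <= Rabs s * ln t)
    by (apply Rmult_le_compat_r; [exact Hln | apply Rle_abs]).
  assert (Hb : ln t <= t / k + ln k).
  { replace t with (t / k * k) at 1 by (field; lra).
    assert (0 < t / k) by (apply Rdiv_lt_0_compat; lra).
    rewrite ln_mult by assumption; apply Rplus_le_compat_r.
    generalize (exp_ineq1_le (ln (t / k))); rewrite exp_ln by assumption; lra. }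
  assert (Rabs s * ln t <= Rabs s * (t / k + ln k)) by (apply Rmult_le_compat_l; lra).
  assert (Rabs s * (t / k) <= t / 2).
  { apply Rmult_le_reg_r with k; [exact Hk |].
    replace (Rabs s * (t / k) * k) with (Rabs s * t) by (field; lra).
    unfold k; nra. }
  lra.
Qed.

(** Near 0 the integrand is at most [t^(s-1)], whose integral over [[a, 1]] is below [1 / s]; on
    [[1, b]] it is at most [exp C * exp (- t / 2)], whose integral is below [2 exp C]. Convergence
    is what identifies the total function [RInt_gen] with a genuine integral. *)
Lemma Gamma_correct (s : R) :
  0 < s -> 0 < Gamma s /\
  is_RInt_gen (fun t => Rpower t (s - 1) * exp (- t))
    (at_right 0) (Rbar_locally p_infty) (Gamma s).
Proof.
  intros Hs; destruct (Rpower_exp_le (s - 1)) as [C HC].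
  destruct (RInt_gen_half_line_pos (fun t => Rpower t (s - 1) * exp (- t))
              (/ s) (2 * exp C)) as [l [Hl Hint]].
  - intros; now apply continuous_Rpower_exp.
  - intros; apply Rmult_lt_0_compat; [apply exp_pos | apply exp_pos].
  - intros a Ha Ha1.
    assert (Hprim : is_RInt (fun t => Rpower t (s - 1)) a 1
                      (minus (Rpower 1 s / s) (Rpower a s / s))).
    { apply (is_RInt_derive (fun t => Rpower t s / s)).
      - intros x [Hx _]; rewrite Rmin_left in Hx by exact Ha1.
        replace (Rpower x (s - 1)) with (s * Rpower x (s - 1) / s) by (field; lra).
        apply is_derive_Reals; apply derivable_pt_lim_div_scal.
        apply derivable_pt_lim_power; lra.
      - intros x [Hx _]; rewrite Rmin_left in Hx by exact Ha1.
        apply (ex_derive_continuous (V := R_NormedModule)); eexists.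
        apply is_derive_Rpower; lra. }
    apply Rle_trans with (RInt (fun t => Rpower t (s - 1)) a 1).
    + apply RInt_le; [exact Ha1 | | eexists; exact Hprim |].
      * apply ex_RInt_half_line; [intros; now apply continuous_Rpower_exp | exact Ha | lra].
      * intros x Hx; rewrite <- (Rmult_1_r (Rpower x (s - 1))) at 2.
        apply Rmult_le_compat_l; [apply Rlt_le, exp_pos |].
        rewrite <- exp_0; apply exp_le; lra.
    + rewrite (is_RInt_unique _ _ _ _ Hprim).
      rewrite Rpower_1_l.
      assert (0 < Rpower a s / s) by (apply Rdiv_lt_0_compat; [apply exp_pos | exact Hs]).
      unfold minus, plus, opp; simpl; unfold Rdiv at 1; lra.
  - intros b Hb.
    assert (Hprim : is_RInt (fun t => exp C * exp (- t / 2)) 1 b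
                      (minus (exp C * (-2 * exp (- b / 2))) (exp C * (-2 * exp (- 1 / 2))))).
    { apply (is_RInt_derive (fun t => exp C * (-2 * exp (- t / 2)))).
      - intros x _; auto_derive; [trivial | unfold Rdiv; field].
      - intros x _; apply (ex_derive_continuous (V := R_NormedModule)).
        auto_derive; trivial. }
    apply Rle_trans with (RInt (fun t => exp C * exp (- t / 2)) 1 b).
    + apply RInt_le; [exact Hb | | eexists; exact Hprim |].
      * apply ex_RInt_half_line; [intros; now apply continuous_Rpower_exp | lra | lra].
      * intros x Hx; apply HC; lra.
    + rewrite (is_RInt_unique _ _ _ _ Hprim).
      unfold minus, plus, opp; simpl.
      assert (0 < exp (- b / 2)) by apply exp_pos.
      assert (exp (- 1 / 2) <= 1) by (rewrite <- exp_0; apply exp_le; lra).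
      assert (0 < exp C) by apply exp_pos.
      nra.
  - unfold Gamma; rewrite (is_RInt_gen_unique _ l Hint); now split.
Qed.

Lemma filterlim_Rpower_exp_at_right_0 (s : R) :
  0 < s -> filterlim (fun t => Rpower t s * exp (- t)) (at_right 0) (locally 0).
Proof.
  intros Hs P [eps HP].
  (* For [0 < t < eps^(1/s)] one has [t^s < eps], and the exponential factor is at most 1. *)
  exists (mkposreal (Rpower eps (/ s)) (exp_pos _)); simpl; intros t Hball Ht.
  apply HP.
  assert (Ht' : t < Rpower eps (/ s)).
  { apply Rabs_def2 in Hball; unfold minus, plus, opp in Hball; simpl in Hball; lra. }
  assert (Hlt : Rpower t s < eps).
  { rewrite <- (Rpower_1 eps) by apply cond_pos.
    rewrite <- (Rinv_l s) by lra; rewrite <- Rpower_mult.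
    apply Rlt_Rpower_l; lra. }
  assert (0 < Rpower t s) by apply exp_pos.
  assert (0 < exp (- t)) by apply exp_pos.
  assert (exp (- t) <= 1) by (rewrite <- exp_0; apply exp_le; lra).
  apply Rabs_def1; unfold minus, plus, opp; simpl; nra.
Qed.

Lemma filterlim_Rpower_exp_pinfty (s : R) :
  filterlim (fun t => Rpower t s * exp (- t)) (Rbar_locally p_infty) (locally 0).
Proof.
  destruct (Rpower_exp_le s) as [C HC].
  intros P [eps HP].
  assert (Heps := cond_pos eps).
  (* Beyond this threshold [C - t / 2 < ln eps]. *)
  exists (Rmax 1 (2 * (C - ln eps))); intros t Ht.
  assert (1 < t) by (apply Rle_lt_trans with (2 := Ht); apply Rmax_l).
  assert (2 * (C - ln eps) < t) by (apply Rle_lt_trans with (2 := Ht); apply Rmax_r).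
  apply HP.
  assert (Hle : Rpower t s * exp (- t) <= exp C * exp (- t / 2)) by (apply HC; lra).
  assert (Hlt : exp C * exp (- t / 2) < eps).
  { rewrite <- exp_plus, <- (exp_ln eps) by exact Heps; apply exp_increasing; lra. }
  assert (0 < Rpower t s * exp (- t)) by (apply Rmult_lt_0_compat; apply exp_pos).
  apply Rabs_def1; unfold minus, plus, opp; simpl; lra.
Qed.

(** Integration by parts: the derivative of [t^s exp (- t)] integrates to 0, since both boundary
    limits vanish ([HD0]), and also to [s * Gamma s - Gamma (s + 1)] by the product rule ([HE]). *)
Lemma Gamma_succ (s : R) : 0 < s -> Gamma (s + 1) = s * Gamma s.
Proof.
  intros Hs.
  destruct (Gamma_correct s Hs) as [_ HI].
  destruct (Gamma_correct (s + 1)) as [_ HI1]; [lra |].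
  assert (HD := is_RInt_gen_minus _ _ _ _ (is_RInt_gen_scal _ s _ HI) HI1).
  assert (HD0 : is_RInt_gen (Derive (fun x => Rpower x s * exp (- x)))
                  (at_right 0) (Rbar_locally p_infty) (0 - 0)).
  { assert (Hfp : forall Q : R -> Prop, (forall x, 0 < x -> Q x) ->
      filter_prod (at_right 0) (Rbar_locally p_infty)
        (fun ab => forall x, Rmin (fst ab) (snd ab) <= x <= Rmax (fst ab) (snd ab) -> Q x)).
    { intros Q HQ; apply Filter_prod with (Q := fun a => 0 < a) (R := fun b => 0 < b).
      - exists (mkposreal 1 Rlt_0_1); tauto.
      - exists 0; tauto.
      - simpl; intros a b Ha Hb x [Hx _]; apply HQ.
        apply Rlt_le_trans with (2 := Hx); now apply Rmin_glb_lt. }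
    apply is_RInt_gen_Derive; try apply Hfp.
    - intros x Hx; eexists; now apply is_derive_Rpower_exp.
    - intros x Hx.
      (* The closed form of [Derive] is known for positive arguments only; the ball of radius [x]
         around [x] stays among them. *)
      apply continuous_ext_loc with (fun t =>
        minus (scal s (Rpower t (s - 1) * exp (- t))) (Rpower t s * exp (- t))).
      + exists (mkposreal x Hx); intros t Ht.
        symmetry; apply is_derive_unique, is_derive_Rpower_exp.
        apply Rabs_def2 in Ht; unfold minus, plus, opp in Ht; simpl in Ht; lra.
      + apply (continuous_minus (V := R_NormedModule)).
        * apply (continuous_scal_r (V := R_NormedModule)), continuous_Rpower_exp, Hx.
        * apply continuous_Rpower_exp, Hx.
    - now apply filterlim_Rpower_exp_at_right_0.
    - apply filterlim_Rpower_exp_pinfty. }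
  assert (HE : is_RInt_gen (Derive (fun x => Rpower x s * exp (- x)))
                  (at_right 0) (Rbar_locally p_infty) (s * Gamma s - Gamma (s + 1))).
  { eapply is_RInt_gen_ext; [| exact HD].
    apply Filter_prod with (Q := fun a => 0 < a) (R := fun b => 0 < b).
    - exists (mkposreal 1 Rlt_0_1); tauto.
    - exists 0; tauto.
    - simpl; intros a b Ha Hb x [Hx _].
      assert (0 < x) by (apply Rlt_trans with (2 := Hx); now apply Rmin_glb_lt).
      replace (s + 1 - 1) with s by ring.
      symmetry; now apply is_derive_unique, is_derive_Rpower_exp. }
  assert (H1 := is_RInt_gen_unique _ _ HD0).
  rewrite (is_RInt_gen_unique _ _ HE) in H1; lra.
Qed.

(** * Minimum principle for [t V' + a V], and monotonicity from the derivative *)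

Lemma is_derive_nonneg_of_right_min (V : R -> R) (x b l : R) :
  x < b -> is_derive V x l -> (forall y, x <= y < b -> V x <= V y) -> 0 <= l.
Proof.
  intros Hb Hd Hmin; apply Rnot_lt_le; intros Hl.
  apply is_derive_Reals in Hd.
  destruct (Hd (- l)) as [delta Hdelta]; [lra |].
  assert (Hd0 := cond_pos delta).
  (* Small enough both to keep the difference quotient within [- l] of [l], hence negative, and to
     keep [x + h] below [b]. *)
  set (h := Rmin (delta / 2) ((b - x) / 2)).
  assert (Hh : 0 < h) by (apply Rmin_glb_lt; lra).
  assert (Hh1 : h <= delta / 2) by apply Rmin_l.
  assert (Hh2 : h <= (b - x) / 2) by apply Rmin_r.
  assert (Hq : (V (x + h) - V x) / h < 0).
  { assert (Hq := Hdelta h); rewrite (Rabs_pos_eq h) in Hq by lra.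
    assert (Rabs ((V (x + h) - V x) / h - l) < - l) as Hq' by (apply Hq; lra).
    apply Rabs_def2 in Hq'; lra. }
  assert (V x <= V (x + h)) by (apply Hmin; lra).
  assert (0 <= (V (x + h) - V x) / h); [| lra].
  apply Rmult_le_pos; [lra | now apply Rlt_le, Rinv_0_lt_compat].
Qed.

Lemma is_derive_nonpos_of_left_min (V : R -> R) (x b l : R) :
  b < x -> is_derive V x l -> (forall y, b < y <= x -> V x <= V y) -> l <= 0.
Proof.
  intros Hb Hd Hmin.
  assert (Hd' : is_derive (fun y => V (- y)) (- x) (- l)).
  { replace (- l) with (scal (-1) l) by (unfold scal; simpl; unfold mult; simpl; ring).
    apply (is_derive_comp V (fun y => - y)).
    - now rewrite Ropp_involutive.
    - auto_derive; [trivial | reflexivity]. }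
  assert (0 <= - l); [| lra].
  apply is_derive_nonneg_of_right_min with (2 := Hd') (b := - b); [lra |].
  intros y Hy; rewrite Ropp_involutive; apply Hmin; lra.
Qed.

(* At a minimum [m] of [V] over [[0,b]] one has [m V'(m) <= 0], so [V m >= 0]. *)
Lemma euler_operator_nonneg (V dV : R -> R) (a b : R) :
  0 < a -> 0 <= b ->
  (forall t, 0 <= t <= b -> is_derive V t (dV t)) ->
  (forall t, 0 <= t <= b -> 0 <= t * dV t + a * V t) ->
  forall t, 0 <= t <= b -> 0 <= V t.
Proof.
  intros Ha Hb Hd Hge.
  destruct (continuity_ab_min V 0 b Hb) as [m [Hmin Hm]].
  { intros c Hc; apply derivable_continuous_pt; exists (dV c).
    now apply is_derive_Reals, Hd. }
  assert (0 <= V m).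
  { assert (m * dV m <= 0).
    { destruct (Req_dec m 0) as [-> | Hm0]; [lra |].
      assert (dV m <= 0); [| nra].
      apply is_derive_nonpos_of_left_min with (V := V) (x := m) (b := 0);
        [lra | now apply Hd |].
      intros y Hy; apply Hmin; lra. }
    generalize (Hge m Hm); intros; nra. }
  intros t Ht; generalize (Hmin t Ht); lra.
Qed.

(** The sign is asked on the open interval only: later derivatives are controlled through their
    product with [t], which says nothing at 0. *)
Lemma nondecreasing_of_derive_nonneg (V dV : R -> R) (x y : R) :
  x <= y ->
  (forall t, x <= t <= y -> is_derive V t (dV t)) ->
  (forall t, x < t < y -> 0 <= dV t) ->
  V x <= V y.
Proof.
  intros [Hxy | ->] Hd Hge; [| apply Rle_refl].
  destruct (MVT_cor2 V dV x y Hxy) as [c [Hc Hcxy]].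
  { intros c Hc; now apply is_derive_Reals, Hd. }
  assert (0 <= dV c * (y - x)); [| lra].
  apply Rmult_le_pos; [now apply Hge | lra].
Qed.

(** * Inequalities for contiguous functions in the variable [t] *)

(* [f], [g], [h] stand for the normalized Bessel functions of orders [nu], [nu + 1],
   [nu + 2], as functions of [t]. *)
Record contiguous (a : R) (f g h : R -> R) : Prop := {
  ctg_pos : 0 < a;
  ctg_f0 : f 0 = 1;
  ctg_g0 : g 0 = 1;
  ctg_h0 : h 0 = 1;
  ctg_df : forall t, is_derive f t (- g t / a);
  ctg_dg : forall t, is_derive g t (- h t / (a + 1));
  ctg_rec : forall t, t * h t = a * (a + 1) * (g t - f t) }.

Definition positive_before (f : R -> R) (T : R) : Prop :=
  0 < T /\ f T = 0 /\ forall t, 0 <= t < T -> 0 < f t.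

(** [auto_derive] sees [f] and [g] as unknown functions; the record [C] supplies their
    differentiability and the values of the resulting [Derive] terms. What remains are domain
    conditions and the algebraic identity of the derivatives. *)
Ltac ctg_derive C :=
  lazymatch type of C with contiguous ?a ?f ?g ?h =>
    auto_derive;
    [ repeat match goal with |- _ /\ _ => split end;
      lazymatch goal with
      | |- ex_derive (fun x => f x) _ => eexists; apply (ctg_df _ _ _ _ C)
      | |- ex_derive (fun x => g x) _ => eexists; apply (ctg_dg _ _ _ _ C)
      | |- True => exact I
      | |- _ => idtac
      end
    | repeat match goal with |- context [Derive ?F ?t] =>
        lazymatch F with
        | (fun x => f x) => replace (Derive F t) with (- g t / a)
            by (symmetry; exact (is_derive_unique _ _ _ (ctg_df _ _ _ _ C t)))
        | (fun x => g x) => replace (Derive F t) with (- h t / (a + 1))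
            by (symmetry; exact (is_derive_unique _ _ _ (ctg_dg _ _ _ _ C t)))
        end
      end ]
  end.

(** The recurrence eliminates [h]. The factor [t] is kept so that the identity also holds at 0. *)
Lemma ctg_dg_mul (a : R) (f g h : R -> R) (t : R) :
  contiguous a f g h -> t * (- h t / (a + 1)) = a * (f t - g t).
Proof.
  intros C; assert (Ha := ctg_pos _ _ _ _ C).
  replace (t * (- h t / (a + 1))) with (- (t * h t) / (a + 1)) by (field; lra).
  rewrite (ctg_rec _ _ _ _ C); field; lra.
Qed.

(** The minimum principle with [V = g]: here [t V' + a V = a f]. *)
Lemma ctg_g_nonneg (a T : R) (f g h : R -> R) :
  contiguous a f g h -> positive_before f T -> forall t, 0 <= t <= T -> 0 <= g t.
Proof.
  intros C [HT [HfT Hf]].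
  assert (Ha := ctg_pos _ _ _ _ C).
  apply euler_operator_nonneg with (dV := fun t => - h t / (a + 1)) (a := a); [lra | lra | |].
  - intros t _; apply (ctg_dg _ _ _ _ C).
  - intros t Ht; rewrite (ctg_dg_mul _ _ _ _ t C).
    assert (0 <= f t); [| nra].
    destruct (Req_dec t T) as [-> | Hne]; [lra | apply Rlt_le, Hf; lra].
Qed.

(** The minimum principle with [V = g - f]: here [t V' + a V = t g / a]. *)
Lemma ctg_f_le_g (a T : R) (f g h : R -> R) :
  contiguous a f g h -> positive_before f T -> forall t, 0 <= t <= T -> f t <= g t.
Proof.
  intros C P; assert (Hg := ctg_g_nonneg _ _ _ _ _ C P); destruct P as [HT _].
  assert (Ha := ctg_pos _ _ _ _ C).
  assert (H : forall t, 0 <= t <= T -> 0 <= g t - f t).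
  { apply euler_operator_nonneg
      with (dV := fun t => - h t / (a + 1) - - g t / a) (a := a); [lra | lra | |].
    - intros t _; apply (is_derive_minus (V := R_NormedModule)).
      + apply (ctg_dg _ _ _ _ C).
      + apply (ctg_df _ _ _ _ C).
    - intros t Ht.
      replace (t * (- h t / (a + 1) - - g t / a) + a * (g t - f t))
        with (t * (- h t / (a + 1)) + a * (g t - f t) + t * g t / a) by (field; lra).
      rewrite (ctg_dg_mul _ _ _ _ t C).
      replace (a * (f t - g t) + a * (g t - f t) + t * g t / a) with (t * g t / a)
        by ring.
      apply Rmult_le_pos; [apply Rmult_le_pos; [lra | now apply Hg] |].
      now apply Rlt_le, Rinv_0_lt_compat. }
  intros t Ht; generalize (H t Ht); lra.
Qed.

(* [(t^a g)' = a t^(a-1) f > 0]; unlike [ctg_f_le_g] this reaches the endpoint [T]. *)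
Lemma ctg_g_pos (a T : R) (f g h : R -> R) :
  contiguous a f g h -> positive_before f T -> forall t, 0 <= t <= T -> 0 < g t.
Proof.
  intros C P; assert (Hg := ctg_g_nonneg _ _ _ _ _ C P).
  destruct P as [HT [HfT Hf]].
  assert (Ha := ctg_pos _ _ _ _ C).
  intros t Ht; destruct (Req_dec t 0) as [-> | Ht0].
  { rewrite (ctg_g0 _ _ _ _ C); lra. }
  destruct (MVT_cor2 (fun s => Rpower s a * g s)
              (fun s => a * Rpower s (a - 1) * g s + Rpower s a * (- h s / (a + 1)))
              (t / 2) t) as [c [Hc Hct]]; [lra | |].
  { intros s Hs; apply (derivable_pt_lim_mult (fun s => Rpower s a)).
    - apply derivable_pt_lim_power; lra.
    - apply is_derive_Reals, (ctg_dg _ _ _ _ C). }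
  assert (Hpow : forall s, 0 < s -> Rpower s a = s * Rpower s (a - 1)).
  { intros s Hs; rewrite <- (Rpower_1 s) at 2 by exact Hs.
    rewrite <- Rpower_plus; f_equal; ring. }
  rewrite (Hpow c) in Hc by lra.
  replace (a * Rpower c (a - 1) * g c + c * Rpower c (a - 1) * (- h c / (a + 1)))
    with (Rpower c (a - 1) * (a * g c + c * (- h c / (a + 1)))) in Hc by ring.
  rewrite (ctg_dg_mul _ _ _ _ c C) in Hc.
  assert (0 < Rpower c (a - 1) * (a * g c + a * (f c - g c)) * (t - t / 2)).
  { replace (a * g c + a * (f c - g c)) with (a * f c) by ring.
    assert (0 < f c) by (apply Hf; lra).
    repeat apply Rmult_lt_0_compat; try apply exp_pos; lra. }
  assert (0 <= Rpower (t / 2) a * g (t / 2)).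
  { apply Rmult_le_pos; [apply Rlt_le, exp_pos | apply Hg; lra]. }
  apply Rmult_lt_reg_l with (Rpower t a); [apply exp_pos | lra].
Qed.

(** The sign of [g'] is that of [t g' = a (f - g) <= 0] for [t > 0]. *)
Lemma ctg_g_nonincreasing (a T : R) (f g h : R -> R) :
  contiguous a f g h -> positive_before f T ->
  forall s t, 0 <= s -> s <= t -> t <= T -> g t <= g s.
Proof.
  intros C P s t Hs Hst Ht; assert (Hle := ctg_f_le_g _ _ _ _ _ C P).
  assert (Ha := ctg_pos _ _ _ _ C).
  assert (- g s <= - g t); [| lra].
  apply nondecreasing_of_derive_nonneg with (V := fun s => - g s)
    (dV := fun s => - (- h s / (a + 1))); [lra | |].
  - intros u _; apply (is_derive_opp (V := R_NormedModule)), (ctg_dg _ _ _ _ C).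
  - intros u Hu; apply Rmult_le_reg_l with u; [lra |].
    rewrite Ropp_mult_distr_r_reverse, (ctg_dg_mul _ _ _ _ u C).
    assert (f u <= g u) by (apply Hle; lra); nra.
Qed.

Lemma ctg_g_le_1 (a T : R) (f g h : R -> R) :
  contiguous a f g h -> positive_before f T -> forall t, 0 <= t <= T -> g t <= 1.
Proof.
  intros C P t Ht; rewrite <- (ctg_g0 _ _ _ _ C).
  apply (ctg_g_nonincreasing _ _ _ _ _ C P); lra.
Qed.

(* The expression is [a t f g] times the derivative of the logarithm of the quotient. *)
Lemma ctg_ln_defect_nonneg (a T : R) (f g h : R -> R) :
  contiguous a f g h -> positive_before f T ->
  forall t, 0 <= t <= T -> 0 <= t * g t ^ 2 - a * (a + 1) * (f t * (g t - f t)).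
Proof.
  intros C P.
  assert (Hg := ctg_g_nonneg _ _ _ _ _ C P).
  assert (Hle := ctg_f_le_g _ _ _ _ _ C P).
  destruct P as [HT _]; assert (Ha := ctg_pos _ _ _ _ C).
  apply euler_operator_nonneg with (a := a) (dV := fun t =>
    g t ^ 2 + t * (2 * g t * (- h t / (a + 1)))
    - a * (a + 1) * ((- g t / a) * (g t - f t)
                     + f t * (- h t / (a + 1) - - g t / a))); [lra | lra | |].
  - intros t _; ctg_derive C; field; lra.
  - intros t Ht; assert (E := ctg_dg_mul _ _ _ _ t C).
    set (dg := - h t / (a + 1)) in *.
    match goal with |- 0 <= ?e => replace e with (2 * (t * g t * (g t - f t))) end.
    + assert (0 <= g t) by now apply Hg.
      assert (f t <= g t) by now apply Hle.
      apply Rmult_le_pos; [lra |]; apply Rmult_le_pos; [nra | lra].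
    (* The intermediate form contains [dg] only in the product [t * dg], which [E] evaluates. *)
    + transitivity (t * g t ^ 2 + 2 * t * g t * (t * dg) - a * (a + 1) *
        (- t * g t / a * (g t - f t) + f t * (t * dg) + f t * t * g t / a)
        + a * (t * g t ^ 2 - a * (a + 1) * (f t * (g t - f t)))).
      * rewrite E; field; lra.
      * field; lra.
Qed.

(** The logarithm of the quotient vanishes at 0 and is nondecreasing, its derivative being the
    defect above divided by [a t f g > 0]. *)
Lemma ctg_lower (a T : R) (f g h : R -> R) :
  contiguous a f g h -> positive_before f T ->
  forall t, 0 <= t < T -> ln (f t) <= (a + 1) / a * ln (g t).
Proof.
  intros C P t Ht.
  assert (HW := ctg_ln_defect_nonneg _ _ _ _ _ C P).
  assert (Hg := ctg_g_pos _ _ _ _ _ C P).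
  destruct P as [HT [HfT Hf]]; assert (Ha := ctg_pos _ _ _ _ C).
  assert ((a + 1) / a * ln (g 0) - ln (f 0) <= (a + 1) / a * ln (g t) - ln (f t)).
  { apply nondecreasing_of_derive_nonneg
      with (V := fun s => (a + 1) / a * ln (g s) - ln (f s)) (dV := fun s =>
        (a + 1) / a * ((- h s / (a + 1)) / g s) - (- g s / a) / f s); [lra | |].
    - intros s Hs; assert (0 < g s) by (apply Hg; lra).
      assert (0 < f s) by (apply Hf; lra).
      ctg_derive C; [assumption | assumption | field; lra].
    - intros s Hs; assert (0 < g s) by (apply Hg; lra).
      assert (0 < f s) by (apply Hf; lra).
      assert (E := ctg_dg_mul _ _ _ _ s C).
      set (dg := - h s / (a + 1)) in *.
      apply Rmult_le_reg_l with (s * (a * f s * g s)).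
      { repeat apply Rmult_lt_0_compat; lra. }
      rewrite Rmult_0_r.
      match goal with |- 0 <= ?e =>
        replace e with ((a + 1) * f s * (s * dg) + s * g s ^ 2) by (field; lra) end.
      rewrite E.
      match goal with |- 0 <= ?e =>
        replace e with (s * g s ^ 2 - a * (a + 1) * (f s * (g s - f s))) by ring end.
      apply HW; lra. }
  rewrite (ctg_f0 _ _ _ _ C), (ctg_g0 _ _ _ _ C), ln_1 in *; lra.
Qed.

(* Equivalent to the concavity of [ln g]. *)
Lemma ctg_log_concave (a T : R) (f g h : R -> R) :
  contiguous a f g h -> positive_before f T ->
  forall t, 0 <= t <= T -> (g t - f t) * (g t + a * f t) <= t * g t ^ 2 / a.
Proof.
  intros C P; destruct P as [HT _]; assert (Ha := ctg_pos _ _ _ _ C).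
  assert (H : forall t, 0 <= t <= T ->
    0 <= t * g t ^ 2 / a - (g t - f t) * (g t + a * f t)).
  { apply euler_operator_nonneg with (a := a) (dV := fun t =>
      (g t ^ 2 + t * (2 * g t * (- h t / (a + 1)))) / a
      - ((- h t / (a + 1) - - g t / a) * (g t + a * f t)
         + (g t - f t) * (- h t / (a + 1) + a * (- g t / a)))); [lra | lra | |].
    - intros t _; ctg_derive C; field; lra.
    - intros t Ht; assert (E := ctg_dg_mul _ _ _ _ t C).
      set (dg := - h t / (a + 1)) in *.
      match goal with |- 0 <= ?e => replace e with (a * (g t - f t) ^ 2) end.
      + apply Rmult_le_pos; [lra | apply pow2_ge_0].
      + transitivity ((t * g t ^ 2 + 2 * t * g t * (t * dg)) / a
          - ((t * dg + t * g t / a) * (g t + a * f t)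
             + (g t - f t) * (t * dg - t * g t))
          + a * (t * g t ^ 2 / a - (g t - f t) * (g t + a * f t))).
        * rewrite E; field; lra.
        * field; lra. }
  intros t Ht; generalize (H t Ht); lra.
Qed.

(* [(g - f) / (t g) = - g' / (a g)] is nondecreasing and equals [1 / T] at [T]. *)
Lemma ctg_upper (a T : R) (f g h : R -> R) :
  contiguous a f g h -> positive_before f T ->
  forall t, 0 <= t < T -> g t * (T - t) <= T * f t.
Proof.
  intros C P t Ht.
  assert (HV := ctg_log_concave _ _ _ _ _ C P).
  assert (Hg := ctg_g_pos _ _ _ _ _ C P).
  destruct P as [HT [HfT Hf]]; assert (Ha := ctg_pos _ _ _ _ C).
  (* At 0 the monotone quotient below has the form 0/0, so this point is checked directly. *)
  destruct (Req_dec t 0) as [-> | Ht0].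
  { rewrite (ctg_f0 _ _ _ _ C), (ctg_g0 _ _ _ _ C); lra. }
  assert (Hq : (g t - f t) / (t * g t) <= (g T - f T) / (T * g T)).
  { apply nondecreasing_of_derive_nonneg
      with (V := fun s => (g s - f s) / (s * g s)) (dV := fun s =>
        ((- h s / (a + 1) - - g s / a) * (s * g s)
         - (g s - f s) * (g s + s * (- h s / (a + 1)))) / (s * g s) ^ 2); [lra | |].
    - intros s Hs; assert (0 < g s) by (apply Hg; lra).
      ctg_derive C; [apply Rgt_not_eq; nra | field; lra].
    - intros s Hs; assert (0 < g s) by (apply Hg; lra).
      assert (E := ctg_dg_mul _ _ _ _ s C).
      set (dg := - h s / (a + 1)) in *.
      apply Rmult_le_pos.
      + match goal with |- 0 <= ?e =>
          replace e with (f s * (s * dg) + s * g s ^ 2 / a - (g s - f s) * g s)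
            by (field; lra) end.
        rewrite E; assert (Hs' : 0 <= s <= T) by lra.
        generalize (HV s Hs'); lra.
      + apply Rlt_le, Rinv_0_lt_compat, pow_lt, Rmult_lt_0_compat; lra. }
  assert (0 < g t) by (apply Hg; lra).
  assert (0 < g T) by (apply Hg; lra).
  rewrite HfT in Hq.
  replace ((g T - 0) / (T * g T)) with (/ T) in Hq by (field; lra).
  apply Rmult_le_compat_r with (r := T * (t * g t)) in Hq;
    [| apply Rlt_le; repeat apply Rmult_lt_0_compat; lra].
  replace (/ T * (T * (t * g t))) with (t * g t) in Hq by (field; lra).
  replace ((g t - f t) / (t * g t) * (T * (t * g t))) with ((g t - f t) * T) in Hq
    by (field; lra).
  lra.
Qed.

(** Since [g <= 1], [f' = - g / a >= - 1 / a]; so [f + t / a] is nondecreasing and is compared with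
    its value at the zero [T]. *)
Lemma ctg_f_le_lin (a T : R) (f g h : R -> R) :
  contiguous a f g h -> positive_before f T ->
  forall t, 0 <= t < T -> f t <= (T - t) / a.
Proof.
  intros C P t Ht.
  assert (Hg := ctg_g_le_1 _ _ _ _ _ C P).
  destruct P as [HT [HfT _]]; assert (Ha := ctg_pos _ _ _ _ C).
  assert (f t + t / a <= f T + T / a); [| rewrite HfT in *; unfold Rdiv in *; lra].
  apply nondecreasing_of_derive_nonneg with (V := fun s => f s + s / a)
    (dV := fun s => - g s / a + / a); [lra | |].
  - intros s _; apply (is_derive_plus (V := R_NormedModule)); [apply (ctg_df _ _ _ _ C) |].
    auto_derive; [trivial | field; lra].
  - intros s Hs; replace (- g s / a + / a) with ((1 - g s) * / a) by (field; lra).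
    apply Rmult_le_pos; [| now apply Rlt_le, Rinv_0_lt_compat].
    assert (g s <= 1) by (apply Hg; lra); lra.
Qed.

(** * Sharpness of the two exponents *)

(** The difference of the two logarithms vanishes at 0, so the hypothesis makes 0 a minimum on
    [[0, T)]. Its derivative there is [- e / T], the contributions [- 1 / a] of [g] and [1 / a] of
    [f] cancelling. *)
Lemma ctg_lower_sharp (a T : R) (f g h : R -> R) (e : R) :
  contiguous a f g h -> positive_before f T ->
  (forall t, 0 <= t < T ->
     e * ln (T / (T - t)) <= (a + 1) / a * ln (g t) - ln (f t)) -> e <= 0.
Proof.
  intros C [HT _] He; assert (Ha := ctg_pos _ _ _ _ C).
  assert (Hd : is_derive (fun t =>
    (a + 1) / a * ln (g t) - ln (f t) - e * ln (T / (T - t))) 0 (- (e / T))).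
  { ctg_derive C.
    - rewrite (ctg_g0 _ _ _ _ C); lra.
    - rewrite (ctg_f0 _ _ _ _ C); lra.
    - lra.
    - apply Rdiv_lt_0_compat; lra.
    - rewrite (ctg_f0 _ _ _ _ C), (ctg_g0 _ _ _ _ C), (ctg_h0 _ _ _ _ C); field; lra. }
  assert (0 <= - (e / T)) as Hle.
  { apply is_derive_nonneg_of_right_min with (2 := Hd) (b := T); [lra |].
    intros t Ht.
    rewrite (ctg_f0 _ _ _ _ C), (ctg_g0 _ _ _ _ C).
    replace (T / (T - 0)) with 1 by (field; lra).
    rewrite ln_1; generalize (He t Ht); lra. }
  apply Rnot_lt_le; intros Hpos.
  assert (0 < e / T) by now apply Rdiv_lt_0_compat.
  lra.
Qed.

(** With [t = T - T exp (- k)] the logarithm of the base is exactly [k], while that of the quotient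
    is at least [k + c] for a fixed [c]. Letting [k] grow forces [1 <= e]. *)
Lemma ctg_upper_sharp (a T : R) (f g h : R -> R) (e : R) :
  contiguous a f g h -> positive_before f T ->
  (forall t, 0 <= t < T ->
     (a + 1) / a * ln (g t) - ln (f t) <= e * ln (T / (T - t))) -> 1 <= e.
Proof.
  intros C P He.
  assert (Hfl := ctg_f_le_lin _ _ _ _ _ C P).
  assert (Hg := ctg_g_pos _ _ _ _ _ C P).
  assert (Hmono := ctg_g_nonincreasing _ _ _ _ _ C P).
  destruct P as [HT [HfT Hf]]; assert (Ha := ctg_pos _ _ _ _ C).
  set (c := (a + 1) / a * ln (g T) + ln a - ln T).
  assert (Hk : forall k, 0 <= k -> k + c <= e * k).
  { intros k Hk.
    assert (Hek : 0 < exp (- k)) by apply exp_pos.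
    assert (exp (- k) <= 1) by (rewrite <- exp_0; apply exp_le; lra).
    set (t := T - T * exp (- k)).
    assert (Ht : 0 <= t < T) by (unfold t; split; nra).
    assert (E : T - t = T * exp (- k)) by (unfold t; ring).
    assert (Hle := He t Ht).
    replace (T / (T - t)) with (exp k) in Hle
      by (rewrite E, exp_Ropp; field; split; [apply Rgt_not_eq, exp_pos | lra]).
    rewrite ln_exp in Hle.
    assert (Hlnf : ln (f t) <= ln T - k - ln a).
    { replace (ln T - k - ln a) with (ln ((T - t) / a)).
      - apply ln_le; [apply Hf | apply Hfl]; exact Ht.
      - rewrite E, ln_div, ln_mult, ln_exp; nra. }
    assert (Hlng : (a + 1) / a * ln (g T) <= (a + 1) / a * ln (g t)).
    { apply Rmult_le_compat_l; [apply Rlt_le, Rdiv_lt_0_compat; lra |].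
      apply ln_le; [apply Hg; lra | apply Hmono; lra]. }
    unfold c; lra. }
  apply Rnot_lt_le; intros Hlt.
  assert (Hc := Rabs_pos c).
  (* For this [k], [(1 - e) k = |c| + 1] exceeds [- c], against [Hk]. *)
  assert (Hk0 : 0 <= (Rabs c + 1) / (1 - e))
    by (apply Rlt_le, Rdiv_lt_0_compat; lra).
  assert (Hkc := Hk _ Hk0).
  assert ((1 - e) * ((Rabs c + 1) / (1 - e)) = Rabs c + 1) by (field; lra).
  assert (- Rabs c <= c) by (generalize (Rle_abs (- c)); rewrite Rabs_Ropp; lra).
  lra.
Qed.

(** * Power series of the normalized Bessel functions *)

Lemma exp_le_inv (x y : R) : exp x <= exp y -> x <= y.
Proof.
  intros Hle; apply Rnot_lt_le; intros Hlt.
  generalize (exp_increasing _ _ Hlt); lra.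
Qed.

(** The Pochhammer symbol [(a)_n]. *)
Fixpoint rising (a : R) (n : nat) : R :=
  match n with
  | O => 1
  | S m => rising a m * (a + INR m)
  end.

Lemma rising_pos (a : R) (n : nat) : 0 < a -> 0 < rising a n.
Proof.
  intros Ha; induction n as [| n IH]; simpl; [lra |].
  apply Rmult_lt_0_compat; [exact IH |].
  generalize (pos_INR n); lra.
Qed.

(** Both sides are [(a)_(n+1)], with the first or the last factor split off. *)
Lemma rising_shift (a : R) (n : nat) : a * rising (a + 1) n = rising a n * (a + INR n).
Proof.
  induction n as [| n IH]; [simpl; ring |].
  simpl rising; rewrite <- Rmult_assoc, IH, S_INR; ring.
Qed.

Lemma Gamma_rising (a : R) (n : nat) : 0 < a -> Gamma (a + INR n) = rising a n * Gamma a.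
Proof.
  intros Ha; induction n as [| n IH]; [simpl; rewrite Rplus_0_r; ring |].
  rewrite S_INR, <- Rplus_assoc, Gamma_succ by (generalize (pos_INR n); lra).
  rewrite IH; simpl; ring.
Qed.

(** Coefficients of the hypergeometric series [0F1(; a; - t)]; Pochhammer symbols replace the Gamma
    quotients, so the series is handled without integrals. *)
Definition bessel_coef (a : R) (n : nat) : R :=
  (-1) ^ n / (INR (fact n) * rising a n).

(** Consecutive coefficients have ratio [- 1 / ((a + n) (n + 1))], at most [1 / (a (n + 1))] in
    absolute value. *)
Lemma CV_radius_bessel_coef (a : R) : 0 < a -> CV_radius (bessel_coef a) = p_infty.
Proof.
  intros Ha.
  assert (Hr := fun n => rising_pos a n Ha).
  apply CV_radius_infinite_DAlembert.
  - intros n; unfold bessel_coef; apply Rmult_integral_contrapositive_currified.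
    + apply pow_nonzero; lra.
    + apply Rinv_neq_0_compat, Rgt_not_eq, Rmult_lt_0_compat;
        [apply INR_fact_lt_0 | apply Hr].
  - apply is_lim_seq_le_le with (u := fun _ => 0) (w := fun n => / a * / INR (S n)).
    + intros n; split; [apply Rabs_pos |].
      assert (Hn := pos_INR n); assert (HSn : 0 < INR (S n)) by (rewrite S_INR; lra).
      replace (bessel_coef a (S n) / bessel_coef a n)
        with (- (/ (a + INR n) * / INR (S n))).
      * rewrite Rabs_Ropp, Rabs_pos_eq
          by (apply Rlt_le, Rmult_lt_0_compat; apply Rinv_0_lt_compat; lra).
        apply Rmult_le_compat_r; [now apply Rlt_le, Rinv_0_lt_compat |].
        apply Rinv_le_contravar; lra.
      * unfold bessel_coef; rewrite fact_simpl, mult_INR; simpl rising; simpl pow.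
        assert (Hf := INR_fact_lt_0 n); assert (Hrn := Hr n).
        field; repeat split; try lra.
        apply pow_nonzero; lra.
    + apply is_lim_seq_const.
    + replace 0 with (/ a * 0) by ring.
      apply (is_lim_seq_scal_l (fun n => / INR (S n)) (/ a) 0).
      apply (is_lim_seq_incr_1 (fun n => / INR n)).
      apply (is_lim_seq_inv INR p_infty); [apply is_lim_seq_INR | discriminate].
Qed.

Lemma is_derive_PSeries_bessel_coef (a t : R) :
  0 < a ->
  is_derive (PSeries (bessel_coef a)) t (- PSeries (bessel_coef (a + 1)) t / a).
Proof.
  intros Ha.
  replace (- PSeries (bessel_coef (a + 1)) t / a)
    with (PSeries (PS_derive (bessel_coef a)) t).
  - apply is_derive_PSeries; rewrite CV_radius_bessel_coef by exact Ha; exact I.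
  - replace (- PSeries (bessel_coef (a + 1)) t / a)
      with (- / a * PSeries (bessel_coef (a + 1)) t) by (field; lra).
    rewrite <- PSeries_scal; apply PSeries_ext; intros n.
    unfold PS_derive, PS_scal, scal, bessel_coef; simpl; unfold mult; simpl.
    assert (Hf := INR_fact_lt_0 n); assert (Hn := pos_INR n).
    assert (Hr := rising_pos a n Ha).
    change (match n with O => 1 | S _ => INR n + 1 end) with (INR (S n)).
    rewrite <- rising_shift.
    rewrite plus_INR, mult_INR, S_INR.
    assert (Ha1 : 0 < a + 1) by lra.
    assert (Hr1 := rising_pos (a + 1) n Ha1).
    field; repeat split; nra.
Qed.

Lemma PSeries_bessel_coef_recurrence (a t : R) :
  0 < a ->
  t * PSeries (bessel_coef (a + 1 + 1)) t =
  a * (a + 1) * (PSeries (bessel_coef (a + 1)) t - PSeries (bessel_coef a) t).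
Proof.
  intros Ha.
  assert (Hex : forall c, 0 < c -> ex_pseries (bessel_coef c) t).
  { intros c Hc; apply CV_radius_inside; rewrite CV_radius_bessel_coef by exact Hc.
    exact I. }
  rewrite <- PSeries_minus by (apply Hex; lra).
  rewrite <- (PSeries_scal (a * (a + 1))), <- PSeries_incr_1; apply PSeries_ext.
  intros [| n]; unfold PS_incr_1, PS_scal, PS_minus, PS_plus, PS_opp, scal, plus, opp;
    simpl; unfold mult; simpl.
  - unfold bessel_coef, zero; simpl; field.
  - unfold bessel_coef.
    assert (Ha1 : 0 < a + 1) by lra; assert (Ha2 : 0 < a + 1 + 1) by lra.
    assert (E1 := rising_shift (a + 1) n); assert (E := rising_shift a (S n)).
    simpl rising in *; rewrite S_INR in E.
    assert (Hn := pos_INR n); assert (Hf := INR_fact_lt_0 n).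
    assert (Hr := rising_pos a n Ha); assert (Hr2 := rising_pos (a + 1 + 1) n Ha2).
    (* All three Pochhammer symbols are expressed through [(a+2)_n], which leaves a rational
       identity for [field]. *)
    assert (Hr1 : rising (a + 1) n = (a + 1) * rising (a + 1 + 1) n / (a + 1 + INR n))
      by (rewrite E1; field; lra).
    assert (Hr0 : rising a n * (a + INR n)
      = a * ((a + 1) * rising (a + 1 + 1) n) / (a + 1 + INR n)).
    { rewrite E1; replace (a * (rising (a + 1) n * (a + 1 + INR n)))
        with (rising a n * (a + INR n) * (a + (INR n + 1))) by lra. field; lra. }
    rewrite Hr0, Hr1, fact_simpl, mult_INR, S_INR; simpl pow.
    field; repeat split; lra.
Qed.

Lemma normBesselJ_PSeries (nu x : R) :
  -1 < nu -> normBesselJ nu x = PSeries (bessel_coef (nu + 1)) ((x / 2) ^ 2).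
Proof.
  intros Hnu; assert (Ha : 0 < nu + 1) by lra.
  apply Series_ext; intros n; unfold bessel_coef.
  replace (nu + INR n + 1) with (nu + 1 + INR n) by ring.
  rewrite Gamma_rising, pow_mult by exact Ha.
  assert (Hr := rising_pos (nu + 1) n Ha); assert (Hf := INR_fact_lt_0 n).
  destruct (Gamma_correct (nu + 1) Ha) as [HG _].
  field; repeat split; lra.
Qed.

(** The prefactor is positive, so this transfers positive zeros between [BesselJ] and the power
    series. *)
Lemma BesselJ_normBesselJ (nu x : R) :
  -1 < nu -> 0 < x ->
  BesselJ nu x = Rpower (x / 2) nu / Gamma (nu + 1) * normBesselJ nu x.
Proof.
  intros Hnu Hx; assert (Ha : 0 < nu + 1) by lra.
  unfold BesselJ, normBesselJ; rewrite <- Series_scal_l.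
  apply Series_ext; intros n.
  replace (nu + INR n + 1) with (nu + 1 + INR n) by ring.
  rewrite Gamma_rising by exact Ha.
  assert (Hr := rising_pos (nu + 1) n Ha); assert (Hf := INR_fact_lt_0 n).
  destruct (Gamma_correct (nu + 1) Ha) as [HG _].
  rewrite Rpower_plus.
  replace (2 * INR n) with (INR (2 * n)) by (rewrite mult_INR; reflexivity).
  rewrite Rpower_pow by lra.
  field; repeat split; lra.
Qed.

Lemma contiguous_bessel (a : R) :
  0 < a ->
  contiguous a (PSeries (bessel_coef a)) (PSeries (bessel_coef (a + 1)))
    (PSeries (bessel_coef (a + 1 + 1))).
Proof.
  intros Ha; split; try (rewrite PSeries_0; unfold bessel_coef; simpl; field);
    [exact Ha | | |].
  - intros t; now apply is_derive_PSeries_bessel_coef.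
  - intros t; apply is_derive_PSeries_bessel_coef; lra.
  - intros t; now apply PSeries_bessel_coef_recurrence.
Qed.

(** A zero [t] of the series in [(0, T)], with [T = (j/2)^2], would give [BesselJ] the zero
    [2 sqrt t < j]. As the series is 1 at 0, the intermediate value theorem leaves only positive
    values before [T]. *)
Lemma positive_before_first_zero (nu j : R) :
  -1 < nu -> is_first_positive_zero (BesselJ nu) j ->
  positive_before (PSeries (bessel_coef (nu + 1))) ((j / 2) ^ 2).
Proof.
  intros Hnu [Hj [Hzero Hfirst]]; assert (Ha : 0 < nu + 1) by lra.
  destruct (Gamma_correct (nu + 1) Ha) as [HG _].
  assert (Hfac : forall x, 0 < Rpower (x / 2) nu / Gamma (nu + 1)).
  { intros x; apply Rdiv_lt_0_compat; [apply exp_pos | exact HG]. }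
  set (f := PSeries (bessel_coef (nu + 1))).
  assert (Hf0 : f 0 = 1) by apply (ctg_f0 _ _ _ _ (contiguous_bessel _ Ha)).
  assert (Hne : forall t, 0 <= t < (j / 2) ^ 2 -> f t <> 0).
  { intros t Ht Hft; destruct (Req_dec t 0) as [-> | Ht0]; [lra |].
    assert (Hs : 0 < sqrt t) by (apply sqrt_lt_R0; lra).
    assert (Hsq : sqrt t ^ 2 = t) by (apply pow2_sqrt; lra).
    assert (j <= 2 * sqrt t); [| nra].
    apply Hfirst; [lra |].
    rewrite BesselJ_normBesselJ, normBesselJ_PSeries by lra.
    replace ((2 * sqrt t / 2) ^ 2) with t by (rewrite <- Hsq at 1; field).
    fold f; rewrite Hft; ring. }
  split; [apply pow_lt; lra | split].
  - rewrite BesselJ_normBesselJ, normBesselJ_PSeries in Hzero by lra.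
    apply Rmult_integral in Hzero; destruct Hzero as [Hzero | Hzero]; [| exact Hzero].
    generalize (Hfac j); lra.
  - intros t Ht; apply Rnot_le_lt; intros Hle.
    destruct (IVT_gen f 0 t 0) as [c [Hc Hfc]].
    + intros x; apply derivable_continuous_pt.
      eexists; apply is_derive_Reals, (ctg_df _ _ _ _ (contiguous_bessel _ Ha)).
    + rewrite Hf0, Rmin_right, Rmax_left; lra.
    + rewrite Rmin_left, Rmax_right in Hc by lra.
      apply (Hne c); [lra | exact Hfc].
Qed.

(** * Return to the variable [x] *)

Theorem theorem3 :
  forall nu j : R,
    -1 < nu ->
    is_first_positive_zero (BesselJ nu) j ->
    let base x := j ^ 2 / (j ^ 2 - x ^ 2) in
    let quotient x :=
      Rpower (normBesselJ (nu + 1) x) ((nu + 2) / (nu + 1)) / normBesselJ nu x in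
    (forall x : R, Rabs x < j ->
       Rpower (base x) 0 <= quotient x <= Rpower (base x) 1) /\
    (forall e : R,
       (forall x : R, Rabs x < j -> Rpower (base x) e <= quotient x) -> e <= 0) /\
    (forall e : R,
       (forall x : R, Rabs x < j -> quotient x <= Rpower (base x) e) -> 1 <= e).
Proof.
  intros nu j Hnu Hzero base quotient.
  assert (Ha : 0 < nu + 1) by lra.
  assert (Hj := proj1 Hzero).
  assert (C := contiguous_bessel _ Ha).
  assert (P := positive_before_first_zero _ _ Hnu Hzero).
  set (f := PSeries (bessel_coef (nu + 1))) in *.
  set (g := PSeries (bessel_coef (nu + 1 + 1))) in *.
  set (T := (j / 2) ^ 2) in *.
  assert (Hg := ctg_g_pos _ _ _ _ _ C P).
  destruct (P) as [HT [_ Hf]].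
  assert (Hrange : forall x, Rabs x < j -> 0 <= (x / 2) ^ 2 < T).
  { intros x Hx; split; [apply pow2_ge_0 |].
    rewrite <- (pow2_abs (x / 2)); unfold Rdiv at 1.
    rewrite Rabs_mult, (Rabs_pos_eq (/ 2)) by lra.
    unfold T; assert (H := Rabs_pos x); nra. }
  assert (Hbase : forall x, Rabs x < j -> base x = T / (T - (x / 2) ^ 2)).
  { intros x Hx; assert (Hr := Hrange x Hx); unfold base; unfold T in *.
    field; nra. }
  (* [Rpower] unfolds to an exponential of a logarithm, so every claim becomes a comparison of
     exponents. *)
  assert (Hquot : forall x, Rabs x < j -> quotient x =
    exp ((nu + 1 + 1) / (nu + 1) * ln (g ((x / 2) ^ 2)) - ln (f ((x / 2) ^ 2)))).
  { intros x Hx; unfold quotient; rewrite !normBesselJ_PSeries by lra; fold f g.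
    unfold Rminus; rewrite exp_plus, exp_Ropp, exp_ln by now apply Hf, Hrange.
    replace (nu + 2) with (nu + 1 + 1) by ring; reflexivity. }
  (* Sharpness in [x] reduces to sharpness in [t] because every [t] of [[0, T)] is reached. *)
  assert (Hsurj : forall t, 0 <= t < T -> exists x, Rabs x < j /\ (x / 2) ^ 2 = t).
  { intros t Ht; exists (2 * sqrt t).
    assert (Hs := sqrt_pos t).
    assert (Hsq : sqrt t ^ 2 = t) by (apply pow2_sqrt; lra).
    split; [rewrite Rabs_pos_eq by lra; unfold T in Ht; nra | rewrite <- Hsq at 2; field]. }
  split; [| split].
  - intros x Hx; assert (Hr := Hrange x Hx).
    rewrite (Hbase x Hx).
    set (t := (x / 2) ^ 2) in *.
    assert (Hb : 0 < T / (T - t)) by (apply Rdiv_lt_0_compat; lra).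
    rewrite Rpower_O, Rpower_1 by exact Hb.
    rewrite (Hquot x Hx); fold t; split.
    + apply Rle_trans with (exp 0); [rewrite exp_0; apply Rle_refl | apply exp_le].
      generalize (ctg_lower _ _ _ _ _ C P t Hr); lra.
    + rewrite <- (exp_ln (T / (T - t))) by exact Hb; apply exp_le.
      assert (Hf' : 0 < f t) by now apply Hf.
      assert (Hg' : 0 < g t) by (apply Hg; lra).
      assert (Hup := ctg_upper _ _ _ _ _ C P t Hr).
      assert (Hg1 : g t <= 1) by (apply (ctg_g_le_1 _ _ _ _ _ C P); lra).
      assert (Hlng : ln (g t) <= 0) by (rewrite <- ln_1; now apply ln_le).
      assert (Hln : ln (g t * (T - t)) <= ln (T * f t))
        by (apply ln_le; [apply Rmult_lt_0_compat; lra | exact Hup]).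
      rewrite !ln_mult in Hln by lra.
      rewrite ln_div by lra.
      (* This splits off the factor [g^(1/a)], at most 1, and leaves the bound of [ctg_upper] for
         [g / f]. *)
      replace ((nu + 1 + 1) / (nu + 1) * ln (g t))
        with (ln (g t) + ln (g t) / (nu + 1)) by (field; lra).
      assert (ln (g t) / (nu + 1) <= 0); [| lra].
      assert (0 < / (nu + 1)) by now apply Rinv_0_lt_compat.
      unfold Rdiv; nra.
  - intros e He; apply (ctg_lower_sharp _ _ _ _ _ e C P).
    intros t Ht; destruct (Hsurj t Ht) as [x [Hx <-]].
    generalize (He x Hx); rewrite (Hbase x Hx), (Hquot x Hx); apply exp_le_inv.
  - intros e He; apply (ctg_upper_sharp _ _ _ _ _ e C P).
    intros t Ht; destruct (Hsurj t Ht) as [x [Hx <-]].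
    generalize (He x Hx); rewrite (Hbase x Hx), (Hquot x Hx); apply exp_le_inv.
Qed.
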